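(* For every $n\in\mathbb{N}$ with $n \equiv 2 \pmod 3$, the integer $1+3\cdot 2^{20n}$ is not a prime number.
   Context: $\mathbb{N}$ denotes the set of natural numbers, including $0$. *)

(* Defs.v *)
From mathcomp Require Export all_boot.

Set Implicit Arguments.
Unset Strict Implicit.
Unset Printing Implicit Defensive.

(* Main.v *)
Require Import Defs.
From mathcomp Require Import all_boot.

(** The number is always a proper multiple of 7: powers of 2 have period 3 modulo 7, and the
    hypothesis forces the exponent [20 * n] to be 1 modulo 3. *)

Theorem proposition3p2 (n : nat) (hn : n = 2 %[mod 3]) :
  ~~ prime (1 + 3 * 2 ^ (20 * n)).
Proof.
(* The remainder 2 of [n] contributes [20 * 2 = 40 = 13 * 3 + 1]. *)
have -> : 20 * n = (20 * (n %/ 3) + 13) * 3 + 1.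
  by rewrite {1}(divn_eq n 3) hn mulnDr mulnA mulnDl -addnA.
set m := _ + 13.
(* Since 2 ^ 3 = 1 %[mod 7], the number is 1 + 3 * 2 = 0 %[mod 7]. *)
have dvd7 : 7 %| 1 + 3 * 2 ^ (m * 3 + 1).
  rewrite /dvdn expnD mulnC [m * 3]mulnC expnM -modnDmr -mulnA -modnMml.
  by rewrite -modnXm exp1n.
(* Exponent 1 would give the prime 7 itself; the summand 13 makes [m] positive, so the exponent is
   at least 2 and [3 * 2 ^ 2 = 12] suffices. *)
have gt7 : 7 < 1 + 3 * 2 ^ (m * 3 + 1).
  rewrite add1n ltnS (@leq_trans (3 * 2 ^ 2)) // leq_pmul2l // leq_exp2l //.
  by rewrite addn1 ltnS muln_gt0 /m addn_gt0 orbT.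
by apply/primePn; right; exists 7.
Qed.
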